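(* Let $S$ be a set of cardinality $n \geq 3$ and $2 \leq r \leq n-1$; fix $X \in \binom{S}{r}$. For $0 \leq h \leq r$ put $p_h := \binom{n-r}{r-h}$, $q_h := \binom{r}{h}$, $m_h := \max\{p_h,q_h\}$, enumerate the $h$-subsets of $X$ as $A^{(h)}_1,\dots,A^{(h)}_{q_h}$ and the $(r-h)$-subsets of $S\setminus X$ as $Z^{(h)}_1,\dots,Z^{(h)}_{p_h}$. For $1 \leq j \leq m_h$ let $s_h(j) := \{A^{(h)}_t \cup Z^{(h)}_{\sigma(t)} : 1 \leq t \leq q_h\}$ (with $\sigma(t)\in\{1,\dots,p_h\}$, $\sigma(t)\equiv j+t-1 \bmod p_h$) if $q_h \leq p_h$, and $s_h(j) := \{A^{(h)}_{\tau(i)} \cup Z^{(h)}_i : 1 \leq i \leq p_h\}$ (with $\tau(i)\in\{1,\dots,q_h\}$, $\tau(i) \equiv j+i-1 \bmod q_h$) if $q_h > p_h$; let $s_h(j) := \emptyset$ for $j > m_h$. Let $\alpha := \max_{h \text{ odd}} m_h$, $\beta := \max_{h \text{ even}} m_h$ (over $0\le h\le r$), $\mathcal{U}^{(odd)}_j := \bigcup_{h \text{ odd}} s_h(j)$ ($1 \leq j \leq \alpha$), $\mathcal{U}^{(even)}_j := \bigcup_{h \text{ even}} s_h(j)$ ($1 \leq j \leq \beta$). For a matroid $M$ on $S$ of rank $r$, let $\mathcal{Q}(M)$ be its set of dependent $r$-subsets (i.e. $\mathcal{C}_r \cup \mathcal{D}_r$, where $\mathcal{C}_r$ is the set of $r$-circuits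 and $\mathcal{D}_r$ the set of dependent $r$-subsets that are not circuits). For $\mathcal{K} \subseteq \binom{S}{r}$ with pairwise intersections of distinct members of size at most $r-2$, let $M_{\mathcal{K}}$ be the matroid on $S$ with set of bases $\binom{S}{r} \setminus \mathcal{K}$ (the sparse-paving matroid of rank $r$ whose set of $r$-circuits is $\mathcal{K}$). Define, for $1 \leq j \leq \alpha$, $M^{(r)}_j := M_{\mathcal{Q}(M) \cap \mathcal{U}^{(odd)}_j}$, and for $\alpha+1 \leq j \leq \alpha+\beta$, $M^{(r)}_j := M_{\mathcal{Q}(M) \cap \mathcal{U}^{(even)}_{j-\alpha}}$. Then each $M^{(r)}_j$ is a well-defined sparse-paving matroid of rank $r$ on $S$, and the map $\Psi_r$ sending a matroid $M$ of rank $r$ on $S$ to the family $\big((M^{(r)}_j, j)\big)_{1 \leq j \leq \alpha+\beta}$ is injective on the set of all matroids of rank $r$ on $S$.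
   Context: A matroid is paving if it has no circuits of cardinality less than its rank; it is sparse-paving if it and its dual are paving. $\binom{S}{t}$ denotes the set of $t$-element subsets of $S$. Matroids on $S$ are considered as set systems on the labelled set $S$. *)

(* Defs.v *)
From HB Require Import structures.
From mathcomp Require Import all_boot.
Set Implicit Arguments.
Unset Strict Implicit.
Unset Printing Implicit Defensive.

Section Matroid.
Variable S : finType.
Implicit Types (A B C D I Y : {set S}) (F K : {set {set S}}).

Definition is_matroid F : bool :=
  (F != set0) &&
  [forall A in F, forall B in F, forall x in A :\: B,
     exists y in B :\: A, (y |: (A :\ x)) \in F].

Record matroid := Matroid { bases : {set {set S}}; _ : is_matroid bases }.
HB.instance Definition _ := [isSub for bases].
HB.instance Definition _ := [Equality of matroid by <:].

Implicit Type M : matroid.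

Lemma bases_neq0 M : exists B, B \in bases M.
Proof. by case: M => F /= /andP[/set0Pn]. Qed.

Lemma bases_exchange M A B x : A \in bases M -> B \in bases M ->
  x \in A :\: B -> exists2 y, y \in B :\: A & (y |: (A :\ x)) \in bases M.
Proof.
case: M => F /= /andP[_ /forall_inP h] AF BF xAB.
by move: (h A AF) => /forall_inP/(_ B BF)/forall_inP/(_ x xAB)/exists_inP.
Qed.

Lemma card_exchange A x y : x \in A -> y \notin A -> #|y |: (A :\ x)| = #|A|.
Proof.
move=> xA yA; rewrite cardsU1 (cardsD1 x A) xA.
by rewrite !inE negb_and yA orbT.
Qed.

Lemma bases_card M A B : A \in bases M -> B \in bases M -> #|A| = #|B|.
Proof.
have [k] := ubnP #|A :\: B|; elim: k A => // k IH A lek AM BM.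
have [AB0|[x xAB]] := set_0Vmem (A :\: B).
  have [BA0|[y yBA]] := set_0Vmem (B :\: A).
    congr #|pred_of_set _|; apply/eqP.
    by rewrite eqEsubset -!setD_eq0 AB0 BA0 eqxx.
  by have [z] := bases_exchange BM AM yBA; rewrite AB0 inE.
have [y yBA A'M] := bases_exchange AM BM xAB.
move: (xAB) (yBA); rewrite !inE => /andP[xB xA] /andP[yA yB].
rewrite -(card_exchange xA yA); apply: IH => //.
rewrite -ltnS; apply: leq_trans lek; rewrite ltnS; apply: proper_card.
apply/properP; split.
  apply/subsetP => z; rewrite !inE => /andP[zB /orP[/eqP zy|/andP[_ zA]]].
    by rewrite zy yB in zB.
  by rewrite zB zA.
by exists x => //; rewrite !inE eqxx /= orbF xB /=; apply: contraNneq xB => ->.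
Qed.

Definition dual_bases M : {set {set S}} := [set ~: B | B in bases M].

Lemma dual_exchange M A B x : A \in bases M -> B \in bases M ->
  x \in B :\: A -> exists2 y, y \in A :\: B & (x |: (A :\ y)) \in bases M.
Proof.
move=> AM BM; rewrite inE => /andP[xA xB].
pose P C := (C \in bases M) && (x |: (A :&: B) \subset C).
have PB : P B.
  by rewrite /P BM; apply/subsetP => z; rewrite !inE => /orP[/eqP->|/andP[]].
case: (arg_maxnP (fun C => #|C :&: A|) PB) => C /andP[CM sC] maxC.
have CsA : C \subset x |: A.
  apply/subsetP => z zC; rewrite !inE; apply: contraT.
  rewrite negb_or => /andP[zx zA].
  have [|y yAC C'M] := @bases_exchange M C A z CM AM; first by rewrite inE zA.
  move: yAC; rewrite inE => /andP[yC yA].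
  have PC' : P (y |: (C :\ z)).
    rewrite /P C'M; apply/subsetP => t tI; have tC := subsetP sC t tI.
    rewrite !inE tC andbT; apply/orP; right; apply/eqP => tz.
    by move: tI; rewrite tz !inE (negbTE zx) (negbTE zA).
  have := maxC _ PC'; rewrite /= leqNgt => /negP[]; apply: proper_card.
  apply/properP; split.
    apply/subsetP => t; rewrite !inE => /andP[tC tA]; rewrite tA tC !andbT.
    by apply/orP; right; apply: contraNneq zA => <-.
  by exists y; rewrite !inE ?eqxx ?yA // (negbTE yC).
have xC : x \in C by apply: (subsetP sC); rewrite !inE eqxx.
have [y yA yC] : exists2 y, y \in A & y \notin C.
  apply/subsetPn; apply/negP => sAC.
  have: x |: A \subset C by rewrite subUset sub1set xC sAC.
  by move/subset_leq_card; rewrite cardsU1 xA (bases_card CM AM) ltnn.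
have yB : y \notin B.
  apply: contra yC => yB; apply: (subsetP sC).
  by rewrite !inE yA yB orbT.
exists y; first by rewrite inE yB yA.
suff <- : C = x |: (A :\ y) by [].
apply/eqP; rewrite eqEcard (card_exchange yA xA) (bases_card CM AM) leqnn andbT.
apply/subsetP => z zC; have := subsetP CsA z zC; rewrite !inE.
case/orP=> [->//|->]; rewrite andbT; apply/orP; right.
by apply: contraNneq yC => <-.
Qed.

Lemma dual_is_matroid M : is_matroid (dual_bases M).
Proof.
apply/andP; split.
  have [B BM] := bases_neq0 M.
  by apply/set0Pn; exists (~: B); apply: imset_f.
apply/forall_inP => _ /imsetP[A AM ->]; apply/forall_inP => _ /imsetP[B BM ->].
apply/forall_inP => x; rewrite !inE negbK => /andP[xB xA].
have [|y] := @dual_exchange M A B x AM BM; first by rewrite inE xA xB.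
rewrite inE => /andP[yB yA] CM; apply/exists_inP; exists y.
  by rewrite !inE yB yA.
apply/imsetP; exists (x |: (A :\ y)) => //.
apply/setP => z; rewrite !inE !negb_or !negb_and negbK.
by case: (eqVneq z x) => [->|//]; rewrite /= orbF; apply: contraNF xA => /eqP->.
Qed.

Definition dual M : matroid := Matroid (dual_is_matroid M).

Definition indep M I : bool := [exists B in bases M, I \subset B].
Definition dependent M D : bool := ~~ indep M D.

Definition circuits M : {set {set S}} := [set C | minset (dependent M) C].

(* All bases have the same cardinality, see [bases_card]. *)
Definition rank M : nat := \max_(B in bases M) #|B|.

Definition paving M : bool := [forall C in circuits M, rank M <= #|C|].
Definition sparse_paving M : bool := paving M && paving (dual M).

Definition ksubsets Y k : {set {set S}} :=
  [set B : {set S} | B \subset Y & #|B| == k].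

Definition dependent_sets M r : {set {set S}} :=
  [set D in ksubsets setT r | dependent M D].

Definition separated r K : Prop :=
  forall A B, A \in K -> B \in K -> A != B -> #|A :&: B| <= r - 2.

Lemma trivial_is_matroid : is_matroid [set set0].
Proof.
apply/andP; split; first by apply/set0Pn; exists set0; rewrite inE.
do 2![apply/forall_inP => ? /set1P->].
by apply/forall_inP => x; rewrite !inE.
Qed.

Definition trivial_matroid : matroid := Matroid trivial_is_matroid.

(* The matroid whose bases are the r-subsets of S outside K. When these do not
   satisfy the basis axioms, the value is the (junk) rank 0 matroid. *)
Definition matroid_of_nonbases r K : matroid :=
  insubd trivial_matroid (ksubsets setT r :\: K).

Definition enumerates (E : seq {set S}) F : Prop := uniq E /\ E =i F.

(* Enumerations are indexed from 1. *)
Definition item (E : seq {set S}) (t : nat) : {set S} := nth set0 E t.-1.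

(* For 0 < k and 0 < p, the representative in {1, ..., p} of k modulo p. *)
Definition residue1 (p k : nat) : nat := (k.-1 %% p).+1.

Section Systems.
(* n is the cardinality of S; A h lists the h-subsets of X, and Z h lists the
   (r - h)-subsets of the complement of X. *)
Variables (n r : nat) (A Z : nat -> seq {set S}).

Definition pcount (h : nat) : nat := 'C(n - r, r - h).
Definition qcount (h : nat) : nat := 'C(r, h).
Definition mcount (h : nat) : nat := maxn (pcount h) (qcount h).

Definition ssys (h j : nat) : {set {set S}} :=
  if mcount h < j then set0
  else if qcount h <= pcount h then
    [set:: [seq item (A h) t :|: item (Z h) (residue1 (pcount h) (j + t - 1))
           | t <- iota 1 (qcount h)]]
  else
    [set:: [seq item (A h) (residue1 (qcount h) (j + i - 1)) :|: item (Z h) i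
           | i <- iota 1 (pcount h)]].

Definition alpha : nat := \max_(h < r.+1 | odd h) mcount h.
Definition beta : nat := \max_(h < r.+1 | ~~ odd h) mcount h.

Definition Uodd (j : nat) : {set {set S}} :=
  \bigcup_(h < r.+1 | odd h) ssys h j.
Definition Ueven (j : nat) : {set {set S}} :=
  \bigcup_(h < r.+1 | ~~ odd h) ssys h j.

Definition nonbases M (j : nat) : {set {set S}} :=
  dependent_sets M r :&: (if j <= alpha then Uodd j else Ueven (j - alpha)).

Definition component M (j : nat) : matroid :=
  matroid_of_nonbases r (nonbases M j).

Definition Psi M : seq (matroid * nat) :=
  [seq (component M j, j) | j <- iota 1 (alpha + beta)].

End Systems.
End Matroid.

(* Main.v *)
Require Import Defs.
From mathcomp Require Import all_boot.
From mathcomp Require Import zify.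

Set Implicit Arguments.
Unset Strict Implicit.
Unset Printing Implicit Defensive.

(** Two members of the same system [s_h(j)] differ both inside and outside [X],
    and members of [s_h(j)] and [s_h'(j)] with [h], [h'] of equal parity have
    traces on [X] whose sizes differ by at least 2; so each [U_j] is separated.
    If [K] is separated, two distinct r-sets meeting in r - 1 points are never
    both in [K], and every axiom or paving condition only requires choosing one
    of two such sets.  Finally, the cyclic shifts [s_h(j)], [1 <= j <= m_h],
    exhaust all the pairs (h-subset of [X], (r-h)-subset of the complement), so
    the [U_j] cover all r-sets and the components of [Psi M] determine all the
    dependent r-sets of [M]. *)

(** * Cardinalities of finite sets *)

Lemma card_setI_lt (T : finType) (A B : {set T}) :
  #|A| = #|B| -> A != B -> #|A :&: B| < #|A|.
Proof.
move=> eAB; apply: contraNltn => leAI; rewrite eqEcard eAB leqnn andbT.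
by apply/setIidPl/eqP; rewrite eqEcard subsetIl.
Qed.

Lemma exists_subset_card (T : finType) (A C : {set T}) k :
  A \subset C -> #|A| <= k <= #|C| ->
  exists B : {set T}, [/\ A \subset B, B \subset C & #|B| = k].
Proof.
move=> sAC /andP[leAk]; rewrite -(subnKC leAk).
elim: (k - #|A|) => [|m IH] ltC; first by exists A; rewrite addn0.
have [|B [sAB sBC cB]] := IH; first lia.
have /properP[_ [x xC xB]] : B \proper C by rewrite properEcard sBC cB; lia.
exists (x |: B); rewrite cardsU1 xB cB subUset sub1set xC sBC.
by split; [exact: subset_trans sAB (subsetUr _ _) | | lia].
Qed.

(** The mixed intersections [B :&: C'] and [C :&: B'] are empty, since [X] separates their two
    sides. *)
Lemma card_setI_split (T : finType) (X B B' C C' : {set T}) :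
  B \subset X -> B' \subset X -> C \subset ~: X -> C' \subset ~: X ->
  #|(B :|: C) :&: (B' :|: C')| <= #|B :&: B'| + #|C :&: C'|.
Proof.
move=> sB sB' sC sC'; apply: leq_trans (leq_card_setU _ _).
apply: subset_leq_card; apply/subsetP => x.
move: (subsetP sB x) (subsetP sB' x) (subsetP sC x) (subsetP sC' x).
rewrite !inE; case: (x \in X) => /= B0 B'0 C0 C'0.
  by case/andP=> /orP[->|/C0//] /orP[->|/C'0].
by case/andP=> /orP[/B0//|->] /orP[/B'0//|->]; rewrite orbT.
Qed.

(** * The sparse-paving matroid of a separated family *)

Section SeparatedMatroid.
Variables (S : finType) (r : nat) (K : {set {set S}}).
Hypotheses (r_ge2 : 2 <= r) (r_lt : r < #|S|).
Hypotheses (sepK : separated r K) (sK : K \subset ksubsets setT r).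

Lemma mem_ksubsetsT (Y : {set S}) k : (Y \in ksubsets setT k) = (#|Y| == k).
Proof. by rewrite inE subsetT. Qed.

Lemma separated_close (A B : {set S}) :
  A != B -> r.-1 <= #|A :&: B| -> (A \notin K) || (B \notin K).
Proof.
move=> AB le; rewrite -negb_and; apply/negP => /andP[AK BK].
have := sepK AK BK AB; lia.
Qed.

(** The two sets are distinct and share [C], one point more than separation allows. *)
Lemma separated_add (C : {set S}) x y :
  #|C| = r.-1 -> x \notin C -> y \notin C -> x != y ->
  (x |: C \notin K) || (y |: C \notin K).
Proof.
move=> cC xC yC xy; apply: separated_close.
  apply: contraNneq xC => e; have : x \in y |: C by rewrite -e setU11.
  by rewrite !inE (negbTE xy).
by rewrite -cC subset_leq_card // subsetI !subsetUr.
Qed.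

(** Counterpart of [separated_add] for the dual: the two sets meet in [C] without [x] and [y], which
    has [r - 1] points. *)
Lemma separated_del (C : {set S}) x y :
  #|C| = r.+1 -> x \in C -> y \in C -> x != y ->
  (C :\ x \notin K) || (C :\ y \notin K).
Proof.
move=> cC xC yC xy; apply: separated_close.
  apply/eqP => /setP/(_ x); rewrite !inE eqxx xC /= => /esym.
  by rewrite andbT (negbTE xy).
have -> : (C :\ x) :&: (C :\ y) = (C :\ x) :\ y.
  by apply/setP => z; rewrite !inE; case: (z \in C); rewrite ?andbT ?andbF // andbC.
have := cardsD1 x C; have := cardsD1 y (C :\ x).
rewrite !inE xC yC eq_sym xy cC; lia.
Qed.

(** Enlarge [Y] to [r - 1] points; as [r < #|S|], two points remain outside, and adding one of them
    avoids [K]. *)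
Lemma superset_nonmember (Y : {set S}) : #|Y| < r ->
  exists B : {set S}, [/\ Y \subset B, #|B| = r & B \notin K].
Proof.
move=> ltY.
have [||C [sYC _ cC]] := @exists_subset_card S Y setT r.-1; first exact: subsetT.
  by rewrite cardsT; lia.
have /card_gt1P[x [y]] : 1 < #|~: C| by have := cardsC C; lia.
rewrite !inE => -[xC yC xy].
have [nK|nK] := orP (separated_add cC xC yC xy).
  exists (x |: C); split=> //; first exact: subset_trans sYC (subsetUr _ _).
  by rewrite cardsU1 xC cC; lia.
exists (y |: C); split=> //; first exact: subset_trans sYC (subsetUr _ _).
by rewrite cardsU1 yC cC; lia.
Qed.

(** Shrink [Y] to [r + 1] points; of two deletions, one avoids [K]. *)
Lemma subset_nonmember (Y : {set S}) : r < #|Y| ->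
  exists B : {set S}, [/\ B \subset Y, #|B| = r & B \notin K].
Proof.
move=> ltY.
have [||C [_ sCY cC]] := @exists_subset_card S set0 Y r.+1; first exact: sub0set.
  by rewrite cards0; lia.
have /card_gt1P[x [y [xC yC xy]]] : 1 < #|C| by lia.
have [nK|nK] := orP (separated_del cC xC yC xy).
  exists (C :\ x); split=> //; first exact: subset_trans (subsetDl _ _) sCY.
  by have := cardsD1 x C; rewrite xC; lia.
exists (C :\ y); split=> //; first exact: subset_trans (subsetDl _ _) sCY.
by have := cardsD1 y C; rewrite yC; lia.
Qed.

Lemma separated_is_matroid : is_matroid (ksubsets setT r :\: K).
Proof.
apply/andP; split.
  have [|B [_ cB nB]] := @superset_nonmember set0; first by rewrite cards0; lia.
  by apply/set0Pn; exists B; rewrite inE nB mem_ksubsetsT cB eqxx.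
apply/forall_inP => A; rewrite inE mem_ksubsetsT => /andP[nA /eqP cA].
apply/forall_inP => B; rewrite inE mem_ksubsetsT => /andP[nB /eqP cB].
apply/forall_inP => x xAB; move: (xAB); rewrite inE => /andP[xB xA].
have cAx : #|A :\ x| = r.-1 by have := cardsD1 x A; rewrite xA; lia.
have memE y : y \in B :\: A ->
    (y |: (A :\ x) \in ksubsets setT r :\: K) = (y |: (A :\ x) \notin K).
  rewrite !inE => /andP[yA yB].
  by rewrite subsetT card_exchange // cA eqxx !andbT.
have eD : #|A :\: B| = #|B :\: A|.
  have := cardsID B A; have := cardsID A B; rewrite setIC; lia.
(* Two candidates for the exchange give sets sharing [A :\ x], so one of them lies outside [K]. *)
have [lt1|le1] := ltnP 1 #|B :\: A|.
  have /card_gt1P[y [z [yD zD yz]]] := lt1.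
  have nin u : u \in B :\: A -> u \notin A :\ x.
    by rewrite !inE => /andP[/negbTE-> _]; rewrite andbF.
  have [nK|nK] := orP (separated_add cAx (nin y yD) (nin z zD) yz).
    by apply/exists_inP; exists y; rewrite ?memE.
  by apply/exists_inP; exists z; rewrite ?memE.
(* With one point in each difference, the exchange turns [A] into [B], which is already a basis. *)
have eD1 : #|A :\: B| == 1.
  by rewrite eqn_leq eD le1 -eD; apply/card_gt0P; exists x.
have /cards1P[y eBA] : #|B :\: A| == 1 by rewrite -eD.
have yD : y \in B :\: A by rewrite eBA set11.
apply/exists_inP; exists y; rewrite // memE //.
suff -> : y |: (A :\ x) = B by [].
have /cards1P[x' eAB] := eD1.
have ex : x = x' by apply/set1P; rewrite -eAB.
apply/setP => z; move/setP/(_ z): eAB; move/setP/(_ z): eBA.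
rewrite -ex !inE.
by case: (z \in A); case: (z \in B); case: (z == x); case: (z == y).
Qed.

Let N := matroid_of_nonbases r K.

(** The axioms hold, so [insubd] does not fall back on its default, the trivial matroid. *)
Lemma bases_of_nonbases : bases N = ksubsets setT r :\: K.
Proof.
rewrite -[bases N]/(val N) /N /matroid_of_nonbases val_insubd.
by rewrite separated_is_matroid.
Qed.

Lemma mem_bases_of_nonbases (B : {set S}) :
  (B \in bases N) = (B \notin K) && (#|B| == r).
Proof. by rewrite bases_of_nonbases inE mem_ksubsetsT. Qed.

Lemma rank_uniform (M : matroid S) k :
  (forall B, B \in bases M -> #|B| = k) -> rank M = k.
Proof.
move=> cM; have [B BM] := bases_neq0 M; apply/eqP; rewrite eqn_leq.
apply/andP; split; first by apply/bigmax_leqP => C /cM->.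
by rewrite -(cM B BM); apply: leq_bigmax_cond.
Qed.

Lemma rank_of_nonbases : rank N = r.
Proof. by apply: rank_uniform => B; rewrite mem_bases_of_nonbases => /andP[_ /eqP]. Qed.

Lemma indep_of_nonbases (Y : {set S}) : #|Y| < r -> indep N Y.
Proof.
case/superset_nonmember => B [sYB cB nB]; apply/exists_inP; exists B => //.
by rewrite mem_bases_of_nonbases nB cB eqxx.
Qed.

Lemma dependent_of_nonbases (Y : {set S}) : #|Y| = r -> dependent N Y = (Y \in K).
Proof.
move=> cY; apply/idP/idP.
  apply: contraNT => nY; apply/exists_inP; exists Y => //.
  by rewrite mem_bases_of_nonbases nY cY eqxx.
move=> YK; apply/exists_inP => -[B]; rewrite mem_bases_of_nonbases.
case/andP=> nB /eqP cB sYB; case/negP: nB.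
suff <- : Y = B by [].
by apply/eqP; rewrite eqEcard sYB cB cY leqnn.
Qed.

Lemma sparse_paving_of_nonbases : sparse_paving N.
Proof.
apply/andP; split; apply/forall_inP => C; rewrite inE => /minsetp depC.
  by rewrite rank_of_nonbases leqNgt; apply: contra depC => /indep_of_nonbases.
have -> : rank (dual N) = #|S| - r.
  apply: rank_uniform => _ /imsetP[B + ->].
  rewrite mem_bases_of_nonbases => /andP[_ /eqP<-].
  by rewrite cardsCs setCK.
(* A set is independent in the dual as soon as its complement contains a basis of [N]. *)
rewrite leqNgt; apply: contra depC => ltC.
have [|B [sBC cB nB]] := @subset_nonmember (~: C).
  by have := cardsC C; lia.
apply/exists_inP; exists (~: B).
  by apply: imset_f; rewrite mem_bases_of_nonbases nB cB eqxx.
by rewrite -setCS setCK.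
Qed.

(** Smaller sets are independent, so each member of [K] is a minimal dependent set. Injectivity uses
    this to read [K] back from the matroid. *)
Lemma circuits_of_nonbases : [set C in circuits N | #|C| == r] = K.
Proof.
apply/setP => C; rewrite !inE; apply/andP/idP.
  by case=> /minsetp depC /eqP cC; rewrite -dependent_of_nonbases.
move=> CK; have := subsetP sK C CK; rewrite mem_ksubsetsT => cC; split=> //.
have eC := eqP cC; apply/minsetP; split=> [|B depB sBC].
  by rewrite dependent_of_nonbases.
apply/eqP; rewrite eqEcard sBC eC leqNgt; apply: contra depB.
exact: indep_of_nonbases.
Qed.

End SeparatedMatroid.

(** * Cyclic shifts and the systems they define *)

Lemma modn_addl_inj p j a b :
  a < p -> b < p -> (j + a) %% p = (j + b) %% p -> a = b.
Proof. by move=> ap bp /eqP; rewrite eqn_modDl !modn_small // => /eqP. Qed.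

Lemma modn_addl_surj p a b :
  a < p -> b < p -> exists2 j, j < p & (j + a) %% p = b.
Proof.
(* The shift is [b - a] modulo [p], written so as to avoid truncated subtraction. *)
move=> ap bp; exists ((b + (p - a)) %% p); first by rewrite ltn_mod; lia.
by rewrite modnDml -addnA subnK ?modnDr ?modn_small // ltnW.
Qed.

Section Systems.
Variables (S : finType) (n r : nat) (X : {set S}) (A Z : nat -> seq {set S}).
Hypotheses (cardS : #|S| = n) (cardX : #|X| = r).
Hypothesis enumA : forall h, h <= r -> enumerates (A h) (ksubsets X h).
Hypothesis enumZ : forall h, h <= r -> enumerates (Z h) (ksubsets (~: X) (r - h)).

Let p := pcount n r.
Let q := qcount r.

(* The matching between the 0-based indices of [A h] and [Z h] that defines
   the system [s_h(j + 1)]. *)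
Definition paired h j a z : bool :=
  if q h <= p h then z == (j + a) %% p h else a == (j + z) %% q h.

(** The smaller index range is shifted modulo the size of the larger one, which is injective. Hence
    distinct members of one system differ in both indices. *)
Lemma paired_inj h j a z a' z' : a < q h -> z < p h -> a' < q h -> z' < p h ->
  paired h j a z -> paired h j a' z' -> (a == a') = (z == z').
Proof.
move=> aq zp a'q z'p; rewrite /paired; case: leqP => [le|lt] /eqP-> /eqP->.
  apply/eqP/eqP => [->//|/modn_addl_inj]; apply; exact: leq_trans le.
by apply/eqP/eqP => [/modn_addl_inj|->//]; apply; apply: ltn_trans lt.
Qed.

Lemma paired_surj h a z : a < q h -> z < p h ->
  exists2 j, j < mcount n r h & paired h j a z.
Proof.
move=> aq zp; rewrite /paired /mcount -/(p h) -/(q h); case: leqP => [le|lt].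
  have [|j jp <-] := @modn_addl_surj (p h) a z _ zp; first exact: leq_trans le.
  by exists j; rewrite ?eqxx.
have [|j jq <-] := @modn_addl_surj (q h) z a _ aq; first exact: ltn_trans lt.
by exists j; rewrite ?eqxx.
Qed.

(** Passes from indices and residues starting at 1 to indices starting at 0, where [residue1]
    becomes the plain remainder of [j + a] or [j + z]. *)
Lemma mem_ssysP h j Y :
  reflect (exists a z, [/\ a < q h, z < p h, j < mcount n r h, paired h j a z
             & Y = nth set0 (A h) a :|: nth set0 (Z h) z])
          (Y \in ssys n r A Z h j.+1).
Proof.
rewrite /ssys -/(p h) -/(q h) /paired; case: (ltnP (mcount n r h) j.+1) => [lt|le].
  by rewrite inE; constructor => -[a [z []]]; lia.
case: (leqP (q h) (p h)) => [leqp|ltpq]; rewrite inE; apply: (iffP mapP).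
- case=> t; rewrite mem_iota => /andP[t1 t2] ->.
  exists t.-1, ((j + t.-1) %% p h); split=> //; first lia.
    by rewrite ltn_mod; lia.
  by rewrite /item /residue1 /=; do 3!f_equal; lia.
- case=> a [z [aq zp _ /eqP ez ->]]; exists a.+1; first by rewrite mem_iota; lia.
  by rewrite ez /item /residue1 /=; do 3!f_equal; lia.
- case=> t; rewrite mem_iota => /andP[t1 t2] ->.
  exists ((j + t.-1) %% q h), t.-1; split=> //; last 1 first.
    by rewrite /item /residue1 /=; do 3!f_equal; lia.
  by rewrite ltn_mod; lia.
  lia.
- case=> a [z [aq zp _ /eqP ea ->]]; exists z.+1; first by rewrite mem_iota; lia.
  by rewrite ea /item /residue1 /=; do 3!f_equal; lia.
Qed.

Lemma size_A h : h <= r -> size (A h) = q h.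
Proof.
case/enumA=> uA eA; rewrite -(card_uniqP uA) (eq_card eA).
by rewrite cards_draws cardX.
Qed.

Lemma size_Z h : h <= r -> size (Z h) = p h.
Proof.
case/enumZ=> uZ eZ; rewrite -(card_uniqP uZ) (eq_card eZ).
by rewrite cards_draws cardsCs setCK cardX cardS.
Qed.

Lemma nth_A h a : h <= r -> a < q h ->
  nth set0 (A h) a \subset X /\ #|nth set0 (A h) a| = h.
Proof.
move=> hr aq; have [_ eA] := enumA hr.
have : nth set0 (A h) a \in A h by rewrite mem_nth ?size_A.
by rewrite eA inE => /andP[? /eqP].
Qed.

Lemma nth_Z h z : h <= r -> z < p h ->
  nth set0 (Z h) z \subset ~: X /\ #|nth set0 (Z h) z| = r - h.
Proof.
move=> hr zp; have [_ eZ] := enumZ hr.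
have : nth set0 (Z h) z \in Z h by rewrite mem_nth ?size_Z.
by rewrite eZ inE => /andP[? /eqP].
Qed.

Lemma ssys_separated h h' j Y Y' : h <= r -> h' <= r -> odd h = odd h' ->
  Y \in ssys n r A Z h j.+1 -> Y' \in ssys n r A Z h' j.+1 -> Y != Y' ->
  #|Y :&: Y'| <= r - 2.
Proof.
move=> hr h'r ohh' /mem_ssysP[a [z [aq zp _ Raz ->]]].
case/mem_ssysP=> a' [z' [a'q z'p _ Raz' ->]] neq.
have [sA cA] := nth_A hr aq; have [sA' cA'] := nth_A h'r a'q.
have [sZ cZ] := nth_Z hr zp; have [sZ' cZ'] := nth_Z h'r z'p.
apply: leq_trans (card_setI_split sA sA' sZ sZ') _.
(* For [h != h'] of equal parity, the bound is [minn h h' + (r - maxn h h')], at most [r - 2]. *)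
have [ehh'|nhh'] := eqVneq h h'; last first.
  have leI (B C : {set S}) : #|B :&: C| <= #|B| /\ #|B :&: C| <= #|C|.
    by rewrite !subset_leq_card ?subsetIl ?subsetIr.
  have := leI (nth set0 (A h) a) (nth set0 (A h') a').
  have := leI (nth set0 (Z h) z) (nth set0 (Z h') z').
  by rewrite cA cA' cZ cZ'; clear -hr h'r ohh' nhh'; lia.
(* For equal [h], both traces differ, so the intersections inside and outside [X] each lose a
   point. *)
subst h'; have e := paired_inj aq zp a'q z'p Raz Raz'.
have naa : a != a'.
  apply: contraNneq neq => eaa; have /eqP ezz : z == z' by rewrite -e eaa.
  by rewrite eaa ezz.
have neqA : nth set0 (A h) a != nth set0 (A h) a'.
  by rewrite nth_uniq ?size_A //; case: (enumA hr).
have neqZ : nth set0 (Z h) z != nth set0 (Z h) z'.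
  by rewrite nth_uniq ?size_Z -?e //; case: (enumZ hr).
have := card_setI_lt (etrans cA (esym cA')) neqA.
have := card_setI_lt (etrans cZ (esym cZ')) neqZ.
by rewrite cA cZ; clear -hr; lia.
Qed.

(** Take [h] to be the size of the trace of [Y] on [X]; some shift matches [Y :&: X] with
    [Y :\: X]. *)
Lemma ssys_cover (Y : {set S}) : #|Y| = r ->
  exists h j, [/\ h <= r, j < mcount n r h & Y \in ssys n r A Z h j.+1].
Proof.
move=> cY; pose h := #|Y :&: X|.
have hr : h <= r by rewrite -cY subset_leq_card ?subsetIl.
have [_ eA] := enumA hr; have [_ eZ] := enumZ hr.
have YA : Y :&: X \in A h by rewrite eA inE subsetIr eqxx.
have YZ : Y :\: X \in Z h.
  rewrite eZ inE setDE subsetIr -setDE.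
  by have := cardsID X Y; rewrite -/h; lia.
have [||j jm Rj] := @paired_surj h (index (Y :&: X) (A h)) (index (Y :\: X) (Z h)).
- by rewrite -size_A ?index_mem.
- by rewrite -size_Z ?index_mem.
exists h, j; split=> //; apply/mem_ssysP.
exists (index (Y :&: X) (A h)), (index (Y :\: X) (Z h)).
by rewrite !nth_index // setID -size_A // -size_Z // !index_mem.
Qed.

Lemma nonbases_separated (M : matroid S) j :
  0 < j -> separated r (nonbases n r A Z M j).
Proof.
move=> j_gt0 Y Y'; rewrite /nonbases !inE => /andP[_ +] /andP[_ +].
case: leqP => [_|ltj].
  case/bigcupP=> h oh Yh /bigcupP[h' oh' Yh'].
  rewrite -(prednK j_gt0) in Yh Yh'.
  by apply: ssys_separated (leq_ord h) (leq_ord h') _ Yh Yh'; rewrite oh oh'.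
case/bigcupP=> h oh Yh /bigcupP[h' oh' Yh'].
have e : j - alpha n r = (j - alpha n r).-1.+1 by lia.
rewrite e in Yh Yh'.
apply: ssys_separated (leq_ord h) (leq_ord h') _ Yh Yh'.
by rewrite (negbTE oh) (negbTE oh').
Qed.

Lemma nonbases_sub (M : matroid S) j :
  nonbases n r A Z M j \subset ksubsets setT r.
Proof. by apply/subsetP => Y; rewrite !inE => /andP[/andP[]]. Qed.

(** The index [j] is chosen before [N], so two matroids can be compared at the same component. *)
Lemma nonbases_cover (Y : {set S}) : #|Y| = r ->
  exists2 j, 0 < j <= alpha n r + beta n r & forall N : matroid S,
    (Y \in nonbases n r A Z N j) = dependent N Y.
Proof.
move=> cY; have [h [j [hr jm Yj]]] := ssys_cover cY.
have hr1 : h < r.+1 by [].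
have memE N (U : {set {set S}}) : Y \in U ->
    (Y \in dependent_sets N r :&: U) = dependent N Y.
  by move=> YU; rewrite !inE YU subsetT cY eqxx andbT.
have [oh|eh] := boolP (odd h).
  have le : mcount n r h <= alpha n r.
    exact: (@leq_bigmax_cond _ (fun i : 'I_r.+1 => odd i) _ (Ordinal hr1)).
  exists j.+1 => [|N]; first lia.
  rewrite /nonbases (leq_trans jm le); apply: memE.
  by apply/bigcupP; exists (Ordinal hr1).
have le : mcount n r h <= beta n r.
  exact: (@leq_bigmax_cond _ (fun i : 'I_r.+1 => ~~ odd i) _ (Ordinal hr1)).
(* The even systems are numbered after the [alpha n r] odd ones. *)
exists (alpha n r + j.+1) => [|N]; first lia.
rewrite /nonbases ifN; last lia.
apply: memE; rewrite addKn.
by apply/bigcupP; exists (Ordinal hr1).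
Qed.

End Systems.

(** * Recovering a matroid from its components *)

Lemma card_bases (S : finType) (M : matroid S) B : B \in bases M -> #|B| = rank M.
Proof.
by move=> BM; rewrite (rank_uniform (k := #|B|)) // => C CM; apply: bases_card CM BM.
Qed.

Lemma mem_bases_dependent (S : finType) (M : matroid S) B :
  (B \in bases M) = (#|B| == rank M) && ~~ dependent M B.
Proof.
apply/idP/andP => [BM|[/eqP cB]].
  by rewrite (card_bases BM) negbK; split=> //; apply/exists_inP; exists B.
rewrite negbK => /exists_inP[C CM sBC].
suff -> : B = C by [].
by apply/eqP; rewrite eqEcard sBC cB (card_bases CM) leqnn.
Qed.


Theorem theorem4p1 (S : finType) (n r : nat) (X : {set S})
    (A Z : nat -> seq {set S})
    (cardS : #|S| = n) (n_ge3 : 3 <= n) (r_ge2 : 2 <= r) (r_le : r <= n - 1)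
    (cardX : #|X| = r)
    (enumA : forall h : nat, h <= r -> enumerates (A h) (ksubsets X h))
    (enumZ : forall h : nat, h <= r ->
       enumerates (Z h) (ksubsets (~: X) (r - h))) :
  (forall (M : matroid S) (j : nat), rank M = r ->
     1 <= j <= alpha n r + beta n r ->
     let K := nonbases n r A Z M j in
     let Mj := component n r A Z M j in
     [/\ separated r K,
         bases Mj = ksubsets [set: S] r :\: K,
         rank Mj = r,
         sparse_paving Mj &
         [set C in circuits Mj | #|C| == r] = K]) /\
  (forall M M' : matroid S, rank M = r -> rank M' = r ->
     Psi n r A Z M = Psi n r A Z M' -> M = M').
Proof.
have r_lt : r < n by lia.
have r_ltS : r < #|S| by rewrite cardS.
have sep := nonbases_separated cardS cardX enumA enumZ.
split=> [M j _ /andP[j_gt0 _] K Mj|M M' rM rM' ePsi].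
  have sepK : separated r K := sep M j j_gt0.
  have sK : K \subset ksubsets setT r := nonbases_sub n r A Z M j.
  split=> //.
  - exact: bases_of_nonbases.
  - exact: rank_of_nonbases.
  - exact: sparse_paving_of_nonbases.
  - exact: circuits_of_nonbases.
(* Equal components have the same [r]-circuits, and these are exactly the nonbases at that index. *)
have eK j : 0 < j <= alpha n r + beta n r ->
    nonbases n r A Z M j = nonbases n r A Z M' j.
  move=> jP; have j_gt0 : 0 < j by case/andP: jP.
  have jI : j \in iota 1 (alpha n r + beta n r) by rewrite mem_iota; lia.
  have /(congr1 fst) /= eC := (eq_in_map _ _ _).2 ePsi j jI.
  rewrite -(circuits_of_nonbases r_ge2 r_ltS (sep M j j_gt0) (nonbases_sub _ _ _ _ _ _)).
  rewrite -[RHS](circuits_of_nonbases r_ge2 r_ltS (sep M' j j_gt0) (nonbases_sub _ _ _ _ _ _)).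
  by rewrite -/(component n r A Z M j) eC.
apply: val_inj; apply/setP => B /=; rewrite !mem_bases_dependent rM rM'.
have [cB|//] := eqVneq #|B| r.
have [j jP dE] := nonbases_cover cardS cardX enumA enumZ cB.
by rewrite -!dE eK.
Qed.
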